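(* Let $n$ be a positive integer. For each integer $N>1$ let $\mathcal{B}_{M}$ be a basis of $M_6(\Gamma_0(N))$ of the form described in the context (Eisenstein series $E_6(q^{\delta})$ for $\delta\mid N$, twisted series $E_{6,\chi}(q^{s})$ for $\chi\in\mathcal{C}$, $s\in D_\chi(N)$, and cusp forms $B_{N,j}=\sum_{n\ge1} b_{N,j}(n)q^n$ for $1\le j\le m_S$). (1) Let $\alpha>1$, $N=\alpha$, and let $X_\delta, Z(\chi)_s, Y_j\in\mathbb{C}$ be the coefficients of $(\alpha E_2(q^\alpha)-E_2(q))E_4(q)$ in $\mathcal{B}_M$. Then $$W_{(\alpha,1)}^{1,3}(n)=\frac{7}{80\alpha}(1+X_1)\sigma_5(n)+\frac1{24}\sigma_3(n)-\frac{1}{8\alpha}n\sigma_3(n)-\frac1{240}\sigma\Big(\frac n\alpha\Big)+\frac{7}{80\alpha}\sum_{\delta\mid\alpha,\,\delta\ne1}X_\delta\sigma_5\Big(\frac n\delta\Big)-\frac{1}{5760\alpha}\sum_{j=1}^{m_S}Y_j b_{\alpha,j}(n)-\frac1{5760\alpha}\sum_{\chi\in\mathcal C}\sum_{s\in D_\chi(\alpha)}Z(\chi)_s\,\chi(n)\sigma_5\Big(\frac ns\Big).$$ (2) Let $\beta>1$, $N=\beta$, and let $X_\delta, Z(\chi)_s, Y_j$ be the coefficients of $E_4(q)(E_2(q)-\beta E_2(q^\beta))$ in $\mathcal{B}_M$. Then $$W_{(1,\beta)}^{3,1}(n)=\frac{7}{80\beta}(1-X_1)\sigma_5(n)+\frac1{24}\sigma_3(n)-\frac{1}{8\beta}n\sigma_3(n)-\frac1{240}\sigma\Big(\frac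 n\beta\Big)-\frac{7}{80\beta}\sum_{\delta\mid\beta,\,\delta\ne1}X_\delta\sigma_5\Big(\frac n\delta\Big)+\frac{1}{5760\beta}\sum_{j=1}^{m_S}Y_j b_{\beta,j}(n)+\frac1{5760\beta}\sum_{\chi\in\mathcal C}\sum_{s\in D_\chi(\beta)}Z(\chi)_s\,\chi(n)\sigma_5\Big(\frac ns\Big).$$ (3) Let $\beta>1$, $N=\beta$, and let $X_\delta, Z(\chi)_s, Y_j$ be the coefficients of $(\beta E_2(q^\beta)-E_2(q))E_4(q^\beta)$ in $\mathcal{B}_M$. Then $$W_{(1,\beta)}^{1,3}(n)=\frac{7}{80}(\beta-X_\beta)\sigma_5\Big(\frac n\beta\Big)+\frac1{24}\sigma_3\Big(\frac n\beta\Big)-\frac18 n\sigma_3\Big(\frac n\beta\Big)-\frac1{240}\sigma(n)-\frac7{80}\sum_{\delta\mid\beta,\,\delta\neq\beta}X_\delta\sigma_5\Big(\frac n\delta\Big)+\frac1{5760}\sum_{j=1}^{m_S}Y_jb_{\beta,j}(n)+\frac1{5760}\sum_{\chi\in\mathcal C}\sum_{s\in D_\chi(\beta)}Z(\chi)_s\,\chi(n)\sigma_5\Big(\frac ns\Big).$$ (4) Let $\alpha>1$, $N=\alpha$, and let $X_\delta, Z(\chi)_s, Y_j$ be the coefficients of $E_4(q^\alpha)(E_2(q)-\alpha E_2(q^\alpha))$ in $\mathcal{B}_M$. Then $$W_{(\alpha,1)}^{3,1}(n)=\frac{7}{80}(\alpha+X_\alpha)\sigma_5\Big(\frac n\alpha\Big)+\frac1{24}\sigma_3\Big(\frac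 n\alpha\Big)-\frac18 n\sigma_3\Big(\frac n\alpha\Big)-\frac1{240}\sigma(n)+\frac7{80}\sum_{\delta\mid\alpha,\,\delta\neq\alpha}X_\delta\sigma_5\Big(\frac n\delta\Big)-\frac1{5760}\sum_{j=1}^{m_S}Y_jb_{\alpha,j}(n)-\frac1{5760}\sum_{\chi\in\mathcal C}\sum_{s\in D_\chi(\alpha)}Z(\chi)_s\,\chi(n)\sigma_5\Big(\frac ns\Big).$$
   Context: For $k\ge 0$, $\sigma_k(n)=\sum_{0<d\mid n}d^k$ for positive integers $n$, and $\sigma_k(x)=0$ if $x$ is not a positive integer; $\sigma=\sigma_1$. For positive integers $\alpha,\beta$ and $(i,j)\in\{(1,3),(3,1)\}$, $W_{(\alpha,\beta)}^{i,j}(n)=\sum_{(k,l)\in\mathbb{N}^2,\ \alpha k+\beta l=n}\sigma_i(k)\sigma_j(l)$, with $\mathbb N=\{0,1,2,\dots\}$. With $q=e^{2\pi iz}$: $E_2(q)=1-24\sum_{n\ge1}\sigma(n)q^n$, $E_4(q)=1+240\sum_{n\ge1}\sigma_3(n)q^n$, $E_6(q)=1-504\sum_{n\ge1}\sigma_5(n)q^n$. $M_6(\Gamma_0(N))$ is the space of modular forms of weight 6 for $\Gamma_0(N)$. $\mathcal{C}$ is a finite (possibly empty) set of primitive Dirichlet characters of conductor $>1$ given by Legendre-Jacobi-Kronecker symbols $\chi(n)=\left(\frac{m}{n}\right)$; for each $\chi\in\mathcal C$, $D_\chi(N)$ is a set of positive divisors of $N$, and $E_{6,\chi}(q^s)=\sum_{n\ge1}\chi(n)\sigma_5(n/s)q^n$.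 The basis is $\mathcal{B}_M=\{E_6(q^{\delta}):\delta\mid N\}\cup\bigcup_{\chi\in\mathcal C}\{E_{6,\chi}(q^s): s\in D_\chi(N)\}\cup\{B_{N,j}:1\le j\le m_S\}$, where $B_{N,j}=\sum_{n\ge1}b_{N,j}(n)q^n$ form a basis of the cusp forms $S_6(\Gamma_0(N))$. ''Coefficients of $F$ in $\mathcal{B}_M$'' means $F=\sum_{\delta\mid N}X_\delta E_6(q^\delta)+\sum_{\chi\in\mathcal{C}}\sum_{s\in D_\chi(N)}Z(\chi)_sE_{6,\chi}(q^s)+\sum_{j=1}^{m_S}Y_jB_{N,j}$. *)

(* Defs.v *)
From Stdlib Require Export Reals ZArith Znumtheory.
From Coquelicot Require Export Coquelicot.
From mathcomp Require Export all_boot.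

Set Implicit Arguments.
Unset Strict Implicit.
Unset Printing Implicit Defensive.

Open Scope C_scope.

Notation "n %:C" := (RtoC (INR n))
  (at level 2, left associativity, format "n %:C") : C_scope.

Notation "\sum_ ( i <- r | P ) F" :=
  (\big[Cplus/RtoC 0]_(i <- r | P%B) F%C) : C_scope.
Notation "\sum_ ( i <- r ) F" := (\big[Cplus/RtoC 0]_(i <- r) F%C) : C_scope.
Notation "\sum_ ( m <= i < n ) F" :=
  (\big[Cplus/RtoC 0]_(m <= i < n) F%C) : C_scope.

Definition sigma (k n : nat) : nat :=
  (\sum_(1 <= d < n.+1 | d %| n) d ^ k)%N.

(* sigma_k(n/d) for d > 0, which vanishes when n/d is not an
   integer. *)
Definition sigma_frac (k n d : nat) : nat :=
  if d %| n then sigma k (n %/ d) else 0%N.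

(* For positive alpha and beta, alpha * k + beta * l = n forces k, l <= n. *)
Definition W (i j alpha beta n : nat) : nat :=
  (\sum_(0 <= k < n.+1)
     \sum_(0 <= l < n.+1 | alpha * k + beta * l == n) sigma i k * sigma j l)%N.

(* The symbol (m/p) for p prime, including (m/2). *)
Definition prime_symbol (m : Z) (p : nat) : Z :=
  let P := Z.of_nat p in
  if (m mod P =? 0)%Z then 0%Z
  else if p == 2%N then
    (if (m mod 8 =? 1)%Z || (m mod 8 =? 7)%Z then 1%Z else (-1)%Z)
  else if has (fun x => (Z.of_nat x ^ 2 mod P =? m mod P)%Z) (iota 0 p)
  then 1%Z else (-1)%Z.

(* The Kronecker symbol (m/n), with (m/0) = 1 iff m = 1 or m = -1, and
   (m/-1) = -1 iff m < 0. *)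
Definition kronecker (m n : Z) : Z :=
  if (n =? 0)%Z then (if (Z.abs m =? 1)%Z then 1%Z else 0%Z)
  else ((if (n <? 0)%Z && (m <? 0)%Z then -1 else 1) *
        \big[Z.mul/1]_(p <- primes (Z.abs_nat n))
           prime_symbol m p ^ Z.of_nat (logn p (Z.abs_nat n)))%Z.

Definition dirichlet_character (f : nat) (chi : Z -> C) : Prop :=
  [/\ chi 1%Z = 1,
      forall m n : Z, chi (m * n)%Z = chi m * chi n,
      forall n : Z, chi (n + Z.of_nat f)%Z = chi n
    & forall n : Z, chi n <> 0 <-> Z.gcd n (Z.of_nat f) = 1%Z].

(* A primitive character modulo f is one of conductor f. *)
Definition primitive_character (f : nat) (chi : Z -> C) : Prop :=
  dirichlet_character f chi /\
  forall d : nat, d %| f -> d != f ->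
    ~ (forall n : Z, Z.gcd n (Z.of_nat f) = 1%Z ->
         (n mod Z.of_nat d = 1 mod Z.of_nat d)%Z -> chi n = 1).

Definition kronecker_character (chi : Z -> C) : Prop :=
  (exists f : nat, (1 < f)%N /\ primitive_character f chi) /\
  exists m : Z, forall n : Z, chi n = RtoC (IZR (kronecker m n)).

(* Modular forms are functions C -> C of which only the values on the upper
   half-plane matter. *)
Definition upper_half_plane (z : C) : Prop := (0 < Im z)%R.

Definition Cexp (z : C) : C :=
  RtoC (exp (Re z)) * (cos (Im z), sin (Im z)).

Definition nome (z : C) : C := Cexp (2 * RtoC PI * Ci * z).

Definition SL2Z (a b c d : Z) : Prop := (a * d - b * c = 1)%Z.

Definition Gamma0 (N : nat) (a b c d : Z) : Prop :=
  SL2Z a b c d /\ (Z.of_nat N | c)%Z.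

Definition ZtoC (m : Z) : C := RtoC (IZR m).

Definition slash (k : nat) (a b c d : Z) (f : C -> C) (z : C) : C :=
  f ((ZtoC a * z + ZtoC b) / (ZtoC c * z + ZtoC d)) /
  Cpow (ZtoC c * z + ZtoC d) k.

Definition holomorphic (f : C -> C) : Prop :=
  forall z, upper_half_plane z ->
    ex_derive (K := C_AbsRing) (V := C_NormedModule) f z.

Definition is_Cseries (a : nat -> C) (l : C) : Prop :=
  is_series (K := C_AbsRing) (V := C_NormedModule) a l.

(* f(z) = sum_(n >= 0) a_n exp(2 pi i n z / h) on the upper half-plane. *)
Definition fourier_expansion (f : C -> C) (h : nat) (a : nat -> C) : Prop :=
  (0 < h)%N /\
  forall z, upper_half_plane z ->
    is_Cseries (fun n => a n * Cpow (nome (z / h%:C)) n) (f z).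

Definition modular_form (k N : nat) (f : C -> C) : Prop :=
  [/\ holomorphic f,
      forall a b c d, Gamma0 N a b c d ->
        forall z, upper_half_plane z -> slash k a b c d f z = f z
    & forall a b c d, SL2Z a b c d ->
        exists h u, fourier_expansion (slash k a b c d f) h u].

Definition cusp_form (k N : nat) (f : C -> C) : Prop :=
  modular_form k N f /\
  forall a b c d, SL2Z a b c d ->
    forall h u, fourier_expansion (slash k a b c d f) h u -> u 0%N = 0.

(* L is a basis of the complex vector space V of functions on the upper
   half-plane. *)
Definition is_basis (V : (C -> C) -> Prop) (L : seq (C -> C)) : Prop :=
  let comb (c : nat -> C) z :=
    \sum_(0 <= i < size L) c i * nth (fun=> RtoC 0) L i z in
  [/\ forall i, (i < size L)%N -> V (nth (fun=> RtoC 0) L i),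
      forall c, (forall z, upper_half_plane z -> comb c z = 0) ->
        forall i, (i < size L)%N -> c i = 0
    & forall f, V f ->
        exists c, forall z, upper_half_plane z -> f z = comb c z].

(* The sum over n >= 1 of a_n q^n; meaningful only when the series converges. *)
Definition qseries (a : nat -> C) (q : C) : C :=
  Hierarchy.iota (T := C_CompleteNormedModule)
    (is_Cseries (fun n => a n.+1 * Cpow q n.+1)).

Definition E2 (q : C) : C := 1 - 24 * qseries (fun n => (sigma 1 n)%:C) q.
Definition E4 (q : C) : C := 1 + 240 * qseries (fun n => (sigma 3 n)%:C) q.
Definition E6 (q : C) : C := 1 - 504 * qseries (fun n => (sigma 5 n)%:C) q.

(* E_{6,chi}(q^s): chi is evaluated at n, not at n/s. *)
Definition E6chi (chi : Z -> C) (s : nat) (q : C) : C :=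
  qseries (fun n => chi (Z.of_nat n) * (sigma_frac 5 n s)%:C) q.

(* [cuspB j] and [cuspb j n], for 1 <= j <= mS, are B_{N,j} as a function of z
   and its Fourier coefficients b_{N,j}(n). *)
Record BM_data := {
  chars : seq (Z -> C);
  Dchi : (Z -> C) -> seq nat;
  mS : nat;
  cuspB : nat -> C -> C;
  cuspb : nat -> nat -> C
}.

Definition cusp_family (B : BM_data) : seq (C -> C) :=
  [seq cuspB B j | j <- iota 1 (mS B)].

Definition BM (N : nat) (B : BM_data) : seq (C -> C) :=
  [seq (fun z => E6 (Cpow (nome z) delta)) | delta <- divisors N] ++
  flatten [seq [seq (fun z => E6chi chi s (nome z)) | s <- Dchi B chi]
          | chi <- chars B] ++
  cusp_family B.

Definition is_BM_basis (N : nat) (B : BM_data) : Prop :=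
  List.NoDup (chars B) /\
  (forall chi, List.In chi (chars B) ->
     [/\ kronecker_character chi,
         uniq (Dchi B chi)
       & {subset Dchi B chi <= divisors N}]) /\
  is_basis (cusp_form 6 N) (cusp_family B) /\
  (forall j, (1 <= j <= mS B)%N -> forall z, upper_half_plane z ->
     is_Cseries (fun n => cuspb B j n.+1 * Cpow (nome z) n.+1) (cuspB B j z)) /\
  is_basis (modular_form 6 N) (BM N B).

(* The function F of q has coefficients X, Z, Y in the basis B_M. *)
Definition coefficients_in_BM (N : nat) (B : BM_data) (F : C -> C)
    (X : nat -> C) (Zc : (Z -> C) -> nat -> C) (Y : nat -> C) : Prop :=
  forall z, upper_half_plane z ->
    F (nome z) =
      \sum_(delta <- divisors N) X delta * E6 (Cpow (nome z) delta)
      + \sum_(chi <- chars B) \sum_(s <- Dchi B chi)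
          Zc chi s * E6chi chi s (nome z)
      + \sum_(1 <= j < (mS B).+1) Y j * cuspB B j z.

(* Main.v *)
From HB Require Import structures.
Require Import Defs.
From mathcomp Require Import zify.
From Stdlib Require Import Lra.

(* The nome takes every real value q with 0 < |q| < 1, so an identity between
   convergent q-series may be compared coefficientwise.  The n-th coefficient of
   E_2(q^a) E_4(q^b) involves W_{(a,b)}^{1,3}(n) linearly; each of the four
   functions is a combination of two such products, in one of which a = b, and
   there the convolution sum is known:
     240 sum_{k+l=n} sigma(k) sigma_3(l)
       = 21 sigma_5(n) + (10 - 30 n) sigma_3(n) - sigma(n).
   This last formula is Liouville's identity for F(x) = x^4, obtained by
   comparing the sums of F(a - b) and F(a + b) over the positive solutions of
   a x + b y = n through the substitutions
     (a,b,x,y) -> (a-b, b, x, x+y), (a+b, a, y, x-y), (a, a+b, x-y, y). *)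

(** * Liouville's identity on the positive solutions of a x + b y = n *)

Lemma big_seq_bij (T U : eqType) (s : seq T) (t : seq U) (P : pred T)
    (Q : pred U) (h : T -> U) (h' : U -> T) (F : U -> nat) :
  uniq s -> uniq t ->
  (forall x, x \in s -> P x -> [/\ h x \in t, Q (h x) & h' (h x) = x]) ->
  (forall y, y \in t -> Q y -> [/\ h' y \in s, P (h' y) & h (h' y) = y]) ->
  (\sum_(x <- s | P x) F (h x) = \sum_(y <- t | Q y) F y)%N.
Proof.
move=> us ut hP hQ; rewrite -big_filter -(big_filter t).
have -> : (\sum_(x <- filter P s) F (h x) =
    \sum_(y <- map h (filter P s)) F y)%N.
  by rewrite big_map.
apply: perm_big; apply: uniq_perm.
- rewrite map_inj_in_uniq ?filter_uniq // => x y.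
  rewrite !mem_filter => /andP[Px xs] /andP[Py ys] e.
  by have [_ _ <-] := hP x xs Px; have [_ _ <-] := hP y ys Py; rewrite e.
- exact: filter_uniq.
move=> y; rewrite mem_filter; apply/mapP/andP.
- case=> x; rewrite mem_filter => /andP[Px xs] ->.
  by have [] := hP x xs Px.
- case=> Qy yt; have [h's Ph' e] := hQ y yt Qy.
  by exists (h' y); rewrite ?mem_filter ?Ph'.
Qed.

Definition grid (n : nat) : seq (nat * nat) :=
  allpairs pair (index_iota 0 n.+1) (index_iota 0 n.+1).

Definition grid4 (n : nat) : seq ((nat * nat) * (nat * nat)) :=
  allpairs pair (grid n) (grid n).

(** The positive solutions of a x + b y = n, stored as ((a, b), (x, y)). Positivity bounds each
    coordinate by n, so the finite grid misses none of them. *)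
Definition quads (n : nat) : seq ((nat * nat) * (nat * nat)) :=
  [seq u <- grid4 n | [&& 0 < u.1.1, 0 < u.1.2, 0 < u.2.1, 0 < u.2.2
    & u.1.1 * u.2.1 + u.1.2 * u.2.2 == n]]%N.

Lemma mem_grid n a b : ((a, b) \in grid n) = (a <= n)%N && (b <= n)%N.
Proof.
have I (x : nat) : (x \in index_iota 0 n.+1) = (x <= n)%N.
  by rewrite mem_index_iota.
apply/allpairsP/andP => [[[x y] /= [+ + [-> ->]]]|[an bn]].
  by rewrite !I.
by exists (a, b); rewrite !I.
Qed.

Lemma mem_grid4 n u v : ((u, v) \in grid4 n) = (u \in grid n) && (v \in grid n).
Proof.
apply/allpairsP/andP => [[[x y] /= [+ + [-> ->]]]//|[un vn]].
by exists (u, v).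
Qed.

Lemma grid_uniq n : uniq (grid n).
Proof. by apply: allpairs_uniq; rewrite ?iota_uniq // => -[? ?] [? ?]. Qed.

Lemma grid4_uniq n : uniq (grid4 n).
Proof. by apply: allpairs_uniq; rewrite ?grid_uniq // => -[? ?] [? ?]. Qed.

Lemma quads_uniq n : uniq (quads n).
Proof. exact/filter_uniq/grid4_uniq. Qed.

Lemma mem_quads n a b x y :
  (((a, b), (x, y)) \in quads n) =
  [&& 0 < a, 0 < b, 0 < x, 0 < y & a * x + b * y == n]%N.
Proof.
rewrite mem_filter mem_grid4 !mem_grid /=.
apply: andb_idr => /and5P[a0 b0 x0 y0 /eqP e].
by apply/andP; split; apply/andP; split; nia.
Qed.

Lemma big_grid n (P : nat -> nat -> bool) (F : nat -> nat -> nat) :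
  (\sum_(u <- grid n | P u.1 u.2) F u.1 u.2 =
   \sum_(0 <= a < n.+1) \sum_(0 <= b < n.+1 | P a b) F a b)%N.
Proof.
rewrite big_mkcond big_allpairs.
by apply: eq_bigr => a _; rewrite [RHS]big_mkcond.
Qed.

Definition quad_swap (u : (nat * nat) * (nat * nat)) :=
  ((u.1.2, u.1.1), (u.2.2, u.2.1)).

Lemma sum_quads_swap n (P : pred ((nat * nat) * (nat * nat)))
    (F : (nat * nat) * (nat * nat) -> nat) :
  (\sum_(u <- quads n | P (quad_swap u)) F (quad_swap u) =
   \sum_(u <- quads n | P u) F u)%N.
Proof.
apply: (@big_seq_bij _ _ _ _ (P \o quad_swap) P quad_swap quad_swap F);
  rewrite ?quads_uniq // => -[[a b] [x y]];
  rewrite /quad_swap /= !mem_quads => /and5P[-> -> -> -> /eqP <-] ->;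
  by rewrite addnC eqxx.
Qed.

(** Rests on a x + b y = (a - b) x + b (x + y): the new second pair (x, x + y) is increasing, and
    every increasing pair arises in this way. *)
Lemma sum_quads_gt n (F : nat -> nat) :
  (\sum_(u <- quads n | u.1.2 < u.1.1) F (u.1.1 - u.1.2) =
   \sum_(u <- quads n | u.2.1 < u.2.2) F u.1.1)%N.
Proof.
(* [h] and [h'] need be inverse only on the selected quadruples, and there the truncated
   subtractions are exact. *)
pose h (u : (nat * nat) * (nat * nat)) :=
  ((u.1.1 - u.1.2, u.1.2), (u.2.1, u.2.1 + u.2.2))%N.
pose h' (u : (nat * nat) * (nat * nat)) :=
  ((u.1.1 + u.1.2, u.1.2), (u.2.1, u.2.2 - u.2.1))%N.
apply: (@big_seq_bij _ _ _ _ _ _ h h' (fun u => F u.1.1));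
  rewrite ?quads_uniq // => -[[a b] [x y]] /=;
  rewrite /h /h' /= !mem_quads => /and5P[? ? ? ? /eqP e] ?; split; try nia.
all: by congr (_, _, (_, _)); lia.
Qed.

(** Rests on a x + b y = (a + b) y + a (x - y). *)
Lemma sum_quads_add n (F : nat -> nat) :
  (\sum_(u <- quads n | u.2.2 < u.2.1) F (u.1.1 + u.1.2) =
   \sum_(u <- quads n | u.1.2 < u.1.1) F u.1.1)%N.
Proof.
pose h (u : (nat * nat) * (nat * nat)) :=
  ((u.1.1 + u.1.2, u.1.1), (u.2.2, u.2.1 - u.2.2))%N.
pose h' (u : (nat * nat) * (nat * nat)) :=
  ((u.1.2, u.1.1 - u.1.2), (u.2.1 + u.2.2, u.2.1))%N.
apply: (@big_seq_bij _ _ _ _ _ _ h h' (fun u => F u.1.1));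
  rewrite ?quads_uniq // => -[[a b] [x y]] /=;
  rewrite /h /h' /= !mem_quads => /and5P[? ? ? ? /eqP e] ?; split; try nia.
all: by congr (_, _, (_, _)); lia.
Qed.

(** Rests on a x + b y = a (x - y) + (a + b) y, which leaves a unchanged. *)
Lemma sum_quads_lt n (F : nat -> nat) :
  (\sum_(u <- quads n | u.2.2 < u.2.1) F u.1.1 =
   \sum_(u <- quads n | u.1.1 < u.1.2) F u.1.1)%N.
Proof.
pose h (u : (nat * nat) * (nat * nat)) :=
  ((u.1.1, u.1.1 + u.1.2), (u.2.1 - u.2.2, u.2.2))%N.
pose h' (u : (nat * nat) * (nat * nat)) :=
  ((u.1.1, u.1.2 - u.1.1), (u.2.1 + u.2.2, u.2.2))%N.
apply: (@big_seq_bij _ _ _ _ _ _ h h' (fun u => F u.1.1));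
  rewrite ?quads_uniq // => -[[a b] [x y]] /=;
  rewrite /h /h' /= !mem_quads => /and5P[? ? ? ? /eqP e] ?; split; try nia.
all: by congr (_, _, (_, _)); lia.
Qed.

Lemma big_ltngtP (T : Type) (s : seq T) (k l : T -> nat) (F : T -> nat) :
  (\sum_(u <- s) F u = \sum_(u <- s | k u < l u) F u +
     \sum_(u <- s | k u == l u) F u + \sum_(u <- s | l u < k u) F u)%N.
Proof.
rewrite !(big_mkcond (fun u => _ < _))%N (big_mkcond (fun u => _ == _)) -!big_split.
apply: eq_bigr => u _ /=.
by case: ltngtP; rewrite ?addn0.
Qed.

(** The sum of two truncated differences encodes |a - b|. The distance sum is split by comparing a
    with b, the sum of F (a + b) by comparing x with y. Up to [quad_swap], each off-diagonal half of
    the former becomes the sum of F a over x < y, and each half of the latter the sum of F a over b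
    < a. Splitting the sum of F a over all quadruples in both ways relates these two. *)
Lemma liouville_identity n (F : nat -> nat) :
  (\sum_(u <- quads n) F (u.1.1 - u.1.2 + (u.1.2 - u.1.1)) +
     \sum_(u <- quads n | u.2.1 == u.2.2) F (u.1.1 + u.1.2) +
     2 * \sum_(u <- quads n | u.2.1 == u.2.2) F u.1.1 =
   \sum_(u <- quads n) F (u.1.1 + u.1.2) +
     \sum_(u <- quads n | u.1.1 == u.1.2) F 0 +
     2 * \sum_(u <- quads n | u.1.1 == u.1.2) F u.1.1)%N.
Proof.
have Edist_lt : (\sum_(u <- quads n | u.1.1 < u.1.2)
      F (u.1.1 - u.1.2 + (u.1.2 - u.1.1)) =
    \sum_(u <- quads n | u.2.1 < u.2.2) F u.1.1)%N.
  rewrite -sum_quads_gt -(@sum_quads_swap n (fun u => u.1.2 < u.1.1)%N).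
  by apply: eq_bigr => -[[a b] v] /= ?; congr F; lia.
have Edist_gt : (\sum_(u <- quads n | u.1.2 < u.1.1)
      F (u.1.1 - u.1.2 + (u.1.2 - u.1.1)) =
    \sum_(u <- quads n | u.2.1 < u.2.2) F u.1.1)%N.
  rewrite -sum_quads_gt.
  by apply: eq_bigr => -[[a b] v] /= ?; congr F; lia.
have Edist_eq : (\sum_(u <- quads n | u.1.1 == u.1.2)
      F (u.1.1 - u.1.2 + (u.1.2 - u.1.1)) =
    \sum_(u <- quads n | u.1.1 == u.1.2) F 0)%N.
  by apply: eq_bigr => u /eqP->; rewrite subnn.
have Eadd : (\sum_(u <- quads n | u.2.1 < u.2.2) F (u.1.1 + u.1.2) =
    \sum_(u <- quads n | u.1.2 < u.1.1) F u.1.1)%N.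
  rewrite -sum_quads_add -(@sum_quads_swap n (fun u => u.2.2 < u.2.1)%N).
  by apply: eq_bigr => -[[a b] v] /= ?; rewrite addnC.
have := @big_ltngtP _ (quads n) (fun u => u.1.1) (fun u => u.1.2)
  (fun u => F u.1.1).
have := @big_ltngtP _ (quads n) (fun u => u.2.1) (fun u => u.2.2)
  (fun u => F u.1.1).
(* The parts x > y and a < b of the sum of F a coincide, so they drop out when its two splittings
   are equated. *)
rewrite sum_quads_lt.
rewrite (@big_ltngtP _ (quads n) (fun u => u.1.1) (fun u => u.1.2)
  (fun u => F (u.1.1 - u.1.2 + (u.1.2 - u.1.1))%N)).
rewrite (@big_ltngtP _ (quads n) (fun u => u.2.1) (fun u => u.2.2)
  (fun u => F (u.1.1 + u.1.2)%N)).
rewrite Edist_lt Edist_gt Edist_eq Eadd sum_quads_add.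
lia.
Qed.

(** * Diagonal sums and the closed form of the convolution with a = b = 1 *)

Lemma big_nat_range n a b (P : pred nat) (F : nat -> nat) :
  (b <= n.+1)%N ->
  (\sum_(a <= i < b | P i) F i =
   \sum_(0 <= i < n.+1 | [&& P i, i < b & a <= i]) F i)%N.
Proof.
move=> bn; rewrite (big_nat_widen _ _ _ _ _ bn) (big_nat_widenl _ 0) //.
by apply: eq_bigl => i; rewrite andbA.
Qed.

(** When x = y the equation reads (a + b) x = n: d = a + b is a divisor of n, it determines x, and a
    runs freely from 1 to d - 1. *)
Lemma sum_quads_diag n (G : nat -> nat -> nat) :
  (\sum_(u <- quads n | u.2.1 == u.2.2) G (u.1.1 + u.1.2) u.1.1 =
   \sum_(1 <= d < n.+1 | d %| n) \sum_(1 <= l < d) G d l)%N.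
Proof.
have -> : (\sum_(1 <= d < n.+1 | d %| n) \sum_(1 <= l < d) G d l =
  \sum_(v <- grid n | [&& 0 < v.1, v.1 %| n & 0 < v.2 < v.1]) G v.1 v.2)%N.
  rewrite (big_grid _ (fun d l => [&& 0 < d, d %| n & 0 < l < d]%N)).
  rewrite (@big_nat_range n) // big_mkcond; apply: eq_big_nat => d /andP[_ dn].
  case: ifP => [/and3P[dvd_d _ d0]|E].
    rewrite (@big_nat_range n); last exact: ltnW.
    apply: eq_bigl => l.
    by rewrite d0 dvd_d /= andbC.
  rewrite big_pred0 // => l; move: E; rewrite dn.
  by case: (d %| n); case: (0 < d)%N.
pose h (u : (nat * nat) * (nat * nat)) := (u.1.1 + u.1.2, u.1.1)%N.
pose h' (v : nat * nat) := ((v.2, v.1 - v.2), (n %/ v.1, n %/ v.1))%N.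
apply: (@big_seq_bij _ _ _ _ _ _ h h' (fun v => G v.1 v.2));
  rewrite ?quads_uniq ?grid_uniq //.
- move=> [[a b] [x y]]; rewrite /h /h' mem_quads mem_grid /=.
  move=> /and5P[a0 b0 x0 y0 /eqP e] /eqP exy.
  have {}e : n = (x * (a + b))%N by rewrite -e exy; lia.
  rewrite e dvdn_mull // mulnK; last lia.
  split; try nia.
  by rewrite -exy; congr (_, _, (_, _)); lia.
- move=> [d l]; rewrite /h /h' mem_quads mem_grid /=.
  move=> /andP[dn ln] /and4P[d0 dvd_d l0 ld].
  have e := divnK dvd_d.
  split=> //; last by congr (_, _); lia.
  have : (0 < n %/ d)%N by nia.
  nia.
Qed.

(** When a = b the equation reads a (x + y) = n, and n / a has n / a - 1 decompositions into two
    positive parts. *)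
Lemma sum_quads_codiag n (F : nat -> nat) :
  (\sum_(u <- quads n | u.1.1 == u.1.2) F u.1.1 =
   \sum_(1 <= d < n.+1 | d %| n) (n %/ d).-1 * F d)%N.
Proof.
have -> : (\sum_(1 <= d < n.+1 | d %| n) (n %/ d).-1 * F d =
  \sum_(v <- grid n | [&& 0 < v.1, v.1 %| n & 0 < v.2 < n %/ v.1]) F v.1)%N.
  rewrite (big_grid _ (fun d l => [&& 0 < d, d %| n & 0 < l < n %/ d]%N)
    (fun d l => F d)).
  rewrite (@big_nat_range n) // big_mkcond; apply: eq_big_nat => d /andP[_ dn].
  case: ifP => [/and3P[dvd_d _ d0]|E].
    rewrite -subn1 -(@sum_nat_const_nat 1) (@big_nat_range n); last first.
      by apply: leq_trans (leq_div _ _) _.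
    by apply: eq_bigl => l; rewrite d0 dvd_d /= andbC.
  rewrite big_pred0 // => l; move: E; rewrite dn.
  by case: (d %| n); case: (0 < d)%N.
pose h (u : (nat * nat) * (nat * nat)) := (u.1.1, u.2.1)%N.
pose h' (v : nat * nat) := ((v.1, v.1), (v.2, n %/ v.1 - v.2))%N.
apply: (@big_seq_bij _ _ _ _ _ _ h h' (fun v => F v.1));
  rewrite ?quads_uniq ?grid_uniq //.
- move=> [[a b] [x y]]; rewrite /h /h' mem_quads mem_grid /=.
  move=> /and5P[a0 b0 x0 y0 /eqP e] /eqP exy.
  have {}e : n = ((x + y) * a)%N by rewrite -e -exy; lia.
  rewrite e dvdn_mull // mulnK //.
  split; try nia.
  by rewrite -exy; congr (_, _, (_, _)); lia.
- move=> [d l]; rewrite /h /h' mem_quads mem_grid /=.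
  move=> /andP[dn ln] /and4P[d0 dvd_d l0 ld].
  have e := divnK dvd_d.
  split=> //.
  nia.
Qed.

(** Pairing each divisor with its cofactor, k = a x and l = b y, turns k + l = n into a x + b y =
    n. *)
Lemma W_sum_quads i j n :
  W i j 1 1 n = (\sum_(u <- quads n) u.1.1 ^ i * u.1.2 ^ j)%N.
Proof.
have sigmaE k m : (m <= n)%N ->
    sigma k m = (\sum_(0 <= d < n.+1 | [&& d %| m, d < m.+1 & 0 < d]) d ^ k)%N.
  by move=> mn; rewrite /sigma (@big_nat_range n).
(* Here [u.1] is (k, l) and [u.2] a pair of divisors. The upper bound on each divisor excludes k = 0
   and l = 0, which every integer divides but where [sigma] is 0. *)
pose P (u : (nat * nat) * (nat * nat)) := [&& u.1.1 + u.1.2 == n,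
  [&& u.2.1 %| u.1.1, u.2.1 < u.1.1.+1 & 0 < u.2.1] &
  [&& u.2.2 %| u.1.2, u.2.2 < u.1.2.+1 & 0 < u.2.2]]%N.
have -> : W i j 1 1 n = (\sum_(u <- grid4 n | P u) u.2.1 ^ i * u.2.2 ^ j)%N.
  rewrite big_mkcond big_allpairs /=.
  rewrite /W -(big_grid n (fun k l => 1 * k + 1 * l == n)%N).
  rewrite big_mkcond big_seq [RHS]big_seq.
  apply: eq_bigr => -[k l]; rewrite mem_grid => /andP[kn ln] /=.
  rewrite !mul1n -big_mkcond /P /=.
  case: eqP => /= _; last by rewrite big_pred0.
  rewrite (big_grid n (fun a b => [&& a %| k, a < k.+1 & 0 < a] &&
    [&& b %| l, b < l.+1 & 0 < b])%N (fun a b => a ^ i * b ^ j)%N).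
  rewrite !sigmaE // big_distrl /= big_mkcond; apply: eq_bigr => a _.
  by case: ifP => _; [rewrite big_distrr | rewrite big_pred0].
pose h (u : (nat * nat) * (nat * nat)) :=
  ((u.2.1, u.2.2), (u.1.1 %/ u.2.1, u.1.2 %/ u.2.2)).
pose h' (u : (nat * nat) * (nat * nat)) :=
  ((u.1.1 * u.2.1, u.1.2 * u.2.2), (u.1.1, u.1.2))%N.
apply: (@big_seq_bij _ _ _ _ _ xpredT h h' (fun u => u.1.1 ^ i * u.1.2 ^ j)%N);
  rewrite ?quads_uniq ?grid4_uniq //.
- move=> [[k l] [a b]]; rewrite mem_quads mem_grid4 !mem_grid /P /h /h' /=.
  move=> /andP[_ _] /and3P[/eqP e /and3P[da ak a0] /and3P[db bl b0]].
  have ea := divnK da; have eb := divnK db.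
  rewrite ![(_ * (_ %/ _))%N]mulnC ea eb; split=> //.
  by rewrite e eqxx a0 b0 !divn_gt0 // !andbT; lia.
- move=> [[a b] [x y]]; rewrite mem_quads mem_grid4 !mem_grid /P /h /h' /=.
  move=> /and5P[a0 b0 x0 y0 /eqP e] _; rewrite !dvdn_mulr // !mulKn //.
  by split=> //; apply/and3P; split; nia.
Qed.

(** Faulhaber's formula for fourth powers, cleared of denominators and subtractions. *)
Lemma sum_pow4 d :
  (30 * \sum_(1 <= l < d) l ^ 4 + 15 * d ^ 4 + d = 6 * d ^ 5 + 10 * d ^ 3)%N.
Proof.
case: d => [|d]; first by rewrite big_geq.
elim: d => [|d IH]; first by rewrite big_geq.
rewrite big_nat_recr //=; move: IH; set s := (\sum_(_ <= _ < _) _)%N.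
by rewrite !expnS !expn0; lia.
Qed.

Lemma W_11 n : (0 < n)%N ->
  (240 * W 1 3 1 1 n + 30 * n * sigma 3 n + sigma 1 n =
   21 * sigma 5 n + 10 * sigma 3 n)%N.
Proof.
move=> n0.
have := liouville_identity n (fun x => x ^ 4)%N.
(* Uses (a + b)^4 = (a - b)^4 + 8 a^3 b + 8 a b^3; the distance sums then cancel in Liouville's
   identity, leaving 16 W. *)
have -> : (\sum_(u <- quads n) (u.1.1 + u.1.2) ^ 4 =
    \sum_(u <- quads n) (u.1.1 - u.1.2 + (u.1.2 - u.1.1)) ^ 4 +
    8 * W 3 1 1 1 n + 8 * W 1 3 1 1 n)%N.
  rewrite !W_sum_quads !big_distrr -!big_split /=.
  apply: eq_bigr => -[[a b] v] _ /=.
  case: (leqP a b) => [/subnKC <- | /ltnW/subnKC <-]; set c := (_ - _)%N;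
    rewrite ?addKn ?subnDA ?subnn ?sub0n ?addn0 ?add0n; rewrite !expnS !expn0; lia.
have -> : W 3 1 1 1 n = W 1 3 1 1 n.
  rewrite !W_sum_quads -(@sum_quads_swap n xpredT).
  by apply: eq_bigr => u _; rewrite mulnC.
rewrite (@sum_quads_diag n (fun d l => d ^ 4)%N).
rewrite (@sum_quads_diag n (fun d l => l ^ 4)%N).
rewrite (@sum_quads_codiag n (fun d => d ^ 4)%N).
have -> : (\sum_(u <- quads n | u.1.1 == u.1.2) 0 ^ 4 = 0)%N by rewrite big1.
set C := (\sum_(_ <= d < _ | _) \sum_(_ <= l < _) l ^ 4)%N.
set D := (\sum_(_ <= d < _ | _) \sum_(_ <= l < _) d ^ 4)%N.
set A := (\sum_(_ <= d < _ | _) _ * _)%N.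
have eC : (30 * C + 15 * sigma 4 n + sigma 1 n = 6 * sigma 5 n + 10 * sigma 3 n)%N.
  rewrite /C /sigma !big_distrr -!big_split /=.
  by apply: eq_bigr => d _; rewrite -sum_pow4 expn1.
have eD : (D + sigma 4 n = sigma 5 n)%N.
  rewrite /D /sigma -big_split big_seq_cond [RHS]big_seq_cond /=.
  apply: eq_bigr => d; rewrite mem_index_iota => /andP[/andP[d0 _] _].
  by rewrite sum_nat_const_nat; case: d d0 => // d _; rewrite !expnS !expn0; lia.
(* Each divisor d contributes (n / d) d^4 = n d^3. *)
have eA : (A + sigma 4 n = n * sigma 3 n)%N.
  rewrite /A /sigma big_distrr -big_split big_seq_cond [RHS]big_seq_cond /=.
  apply: eq_bigr => d; rewrite mem_index_iota => /andP[/andP[d0 dn] dvd_d].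
  have := divnK dvd_d; have : (0 < n %/ d)%N by rewrite divn_gt0.
  by case: (n %/ d)%N => // q _ <- /=; rewrite !expnS !expn0; lia.
(* What remains is 16 W + 2 A = D + 2 C; multiplied by 15, all occurrences of [sigma 4 n] cancel. *)
nia.
Qed.

(** * W as a convolution, and its behaviour under dilation *)

Lemma sigma_frac1 k n : sigma_frac k n 1 = sigma k n.
Proof. by rewrite /sigma_frac dvd1n divn1. Qed.

Lemma W_comm i j a b n : W i j a b n = W j i b a n.
Proof.
rewrite /W; under eq_bigr do rewrite big_mkcond; rewrite exchange_big_nat /=.
apply: eq_bigr => l _; rewrite [RHS]big_mkcond /=; apply: eq_bigr => k _.
by rewrite addnC [(sigma i k * _)%N]mulnC.
Qed.

Lemma sigma_frac_sum i m a n : (0 < a)%N -> (m <= n)%N ->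
  sigma_frac i m a = (\sum_(0 <= k < n.+1 | a * k == m) sigma i k)%N.
Proof.
move=> a0 mn; rewrite /sigma_frac; case: ifP => [/dvdnP[q e]|ndvd].
  rewrite e mulnK //.
  rewrite (eq_bigl (pred1 q)) => [|k]; last by rewrite mulnC eqn_pmul2r.
  have qn : (q < n.+1)%N by nia.
  by rewrite -big_filter filter_pred1_uniq ?iota_uniq ?mem_index_iota // big_seq1.
by rewrite big_pred0 // => k; apply: contraFF ndvd => /eqP <-; apply: dvdn_mulr.
Qed.

(** Grouping by m = a k shows W to be a Cauchy product coefficient of two dilated divisor series,
    the form in which it occurs in a product of Eisenstein series. *)
Lemma W_convolution i j a b n : (0 < a)%N -> (0 < b)%N ->
  W i j a b n = (\sum_(0 <= m < n.+1) sigma_frac i m a * sigma_frac j (n - m) b)%N.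
Proof.
move=> a0 b0.
transitivity (\sum_(0 <= m < n.+1) \sum_(0 <= k < n.+1)
    if a * k == m then
      sigma i k * \sum_(0 <= l < n.+1 | b * l == n - m) sigma j l else 0)%N;
  last first.
  apply: eq_big_nat => m /andP[_ mn].
  rewrite (@sigma_frac_sum i m a n) // (@sigma_frac_sum j (n - m) b n) ?leq_subr //.
  by rewrite big_distrl /= [RHS]big_mkcond.
rewrite exchange_big_nat; apply: eq_bigr => k _ /=.
case: (leqP (a * k) n) => akn; last first.
  rewrite big_pred0 => [|l]; last by apply/eqP; lia.
  rewrite big_nat big1 // => m /andP[_ mn]; case: eqP => // e; lia.
rewrite [RHS](bigD1_seq (a * k)%N) ?iota_uniq ?mem_index_iota //= eqxx.
rewrite [X in _ = (_ + X)%N]big1 ?addn0; last first.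
  by move=> m; rewrite eq_sym => /negPf->.
rewrite big_distrr /=; apply: eq_bigl => l; apply/eqP/eqP; lia.
Qed.

(** Positivity of a and b forces k, l <= n, so a longer range adds only empty terms. This reconciles
    the ranges for n and n / a in [W_dilate]. *)
Lemma W_widen i j a b n N : (0 < a)%N -> (0 < b)%N -> (n <= N)%N ->
  W i j a b n = (\sum_(0 <= k < N.+1)
    \sum_(0 <= l < N.+1 | a * k + b * l == n) sigma i k * sigma j l)%N.
Proof.
move=> a0 b0 nN.
rewrite [RHS](@big_cat_nat _ _ _ n.+1) //= [X in (_ + X)%N]big_nat.
rewrite [X in (_ + X)%N]big1 ?addn0; last first.
  by move=> k /andP[nk _]; rewrite big_pred0 // => l; apply/eqP; nia.
apply: eq_bigr => k _; rewrite (big_nat_widen _ _ N.+1) //.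
by apply: eq_bigl => l; apply/andP/idP => [[]//|/eqP e]; split; [apply/eqP | nia].
Qed.

Lemma W_dilate i j a n : (0 < a)%N ->
  W i j a a n = (if a %| n then W i j 1 1 (n %/ a) else 0)%N.
Proof.
move=> a0; case: ifP => [/dvdnP[m ->]|ndvd]; last first.
  rewrite /W big1 // => k _; rewrite big_pred0 // => l.
  by apply: contraFF ndvd => /eqP <-; rewrite -mulnDr dvdn_mulr.
rewrite mulnK // (@W_widen _ _ 1 1 m (m * a)) //; last by rewrite leq_pmulr.
apply: eq_bigr => k _; apply: eq_bigl => l.
by rewrite -mulnDr mulnC eqn_pmul2r // !mul1n.
Qed.

(* After loading MathComp the key [%R] delimits its own ring_scope. *)
Delimit Scope R_scope with Re.

(* The value [f q] is required only for real [q] with 0 < |q| < 1: these are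
   values of the nome and suffice to determine the coefficients. *)
Definition qexp (c : nat -> C) (f : C -> C) : Prop :=
  forall r : R, (0 < Rabs r < 1)%Re ->
    is_Cseries (fun n => c n * Cpow (RtoC r) n) (f (RtoC r)).

(** * Complex series and linear operations on q-expansions *)

Lemma is_Cseries_Re (a : nat -> C) l :
  is_Cseries a l -> is_series (fun n => Re (a n)) (Re l).
Proof.
move=> /filterlim_locally H; apply/filterlim_locally => eps.
have [N HN] := H eps; exists N => n /HN [+ _].
have -> // : fst (sum_n a n) = sum_n (fun n => Re (a n)) n.
elim: n => [|n IH]; first by rewrite !sum_O.
by rewrite !sum_Sn -IH.
Qed.

Lemma is_Cseries_Im (a : nat -> C) l :
  is_Cseries a l -> is_series (fun n => Im (a n)) (Im l).
Proof.
move=> /filterlim_locally H; apply/filterlim_locally => eps.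
have [N HN] := H eps; exists N => n /HN [_ +].
have -> // : snd (sum_n a n) = sum_n (fun n => Im (a n)) n.
elim: n => [|n IH]; first by rewrite !sum_O.
by rewrite !sum_Sn -IH.
Qed.

Lemma is_Cseries_RtoC (a : nat -> R) l :
  is_series a l -> is_Cseries (fun n => RtoC (a n)) (RtoC l).
Proof.
move=> /filterlim_locally H; apply/filterlim_locally => eps.
have [N HN] := H eps; exists N => n /HN.
have -> : sum_n (fun n => RtoC (a n)) n = RtoC (sum_n a n).
  elim: n => [|n IH]; first by rewrite !sum_O.
  by rewrite !sum_Sn IH; symmetry; apply: RtoC_plus.
by move=> b; split=> //; apply: ball_center.
Qed.

Lemma is_Cseries_unique (a : nat -> C) l l' :
  is_Cseries a l -> is_Cseries a l' -> l = l'.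
Proof. exact (@filterlim_locally_unique _ _ _ _ _ (sum_n a) l l'). Qed.

Lemma qseriesE (a : nat -> C) q l :
  is_Cseries (fun n => a n.+1 * Cpow q n.+1) l -> qseries a q = l.
Proof.
move=> H; refine (is_Cseries_unique _ _ _ _ H).
apply (@iota_correct _ C_CompleteNormedModule
  (is_Cseries (fun n => a n.+1 * Cpow q n.+1))).
by exists l; split; [exact: H | move=> l'; apply: is_Cseries_unique].
Qed.

Lemma qexp_ext (c d : nat -> C) f : c =1 d -> qexp c f -> qexp d f.
Proof. by move=> e H r /H; apply: is_series_ext => n; rewrite e. Qed.

Lemma qexp_plus (c d : nat -> C) f g :
  qexp c f -> qexp d g -> qexp (fun n => c n + d n) (fun q => f q + g q).
Proof.
move=> Hf Hg r hr; have := is_series_plus _ _ _ _ (Hf r hr) (Hg r hr).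
by apply: is_series_ext => n; rewrite Cmult_plus_distr_r.
Qed.

Lemma qexp_scal x (c : nat -> C) f :
  qexp c f -> qexp (fun n => x * c n) (fun q => x * f q).
Proof.
move=> Hf r hr; have := is_series_scal x _ _ (Hf r hr).
by apply: is_series_ext => n; rewrite -Cmult_assoc.
Qed.

Lemma qexp_0 : qexp (fun=> RtoC 0) (fun=> RtoC 0).
Proof.
move=> r _; apply/filterlim_locally => eps; exists 0%N => n _.
have -> : sum_n (fun n => RtoC 0 * Cpow (RtoC r) n) n = RtoC 0.
  elim: n => [|n IH]; first by rewrite sum_O Cmult_0_l.
  by rewrite sum_Sn IH Cmult_0_l; apply: Cplus_0_l.
exact: ball_center.
Qed.

Lemma qexp_1 : qexp (fun n => if n == 0%N then RtoC 1 else RtoC 0) (fun=> RtoC 1).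
Proof.
move=> r hr; apply: is_series_decr_1 => /=.
have -> : plus (RtoC 1) (opp (RtoC 1 * RtoC 1)) = RtoC 0.
  by rewrite Cmult_1_l; apply: Cplus_opp_r.
have := qexp_0 r hr; apply: is_series_ext => n; by rewrite !Cmult_0_l.
Qed.

Lemma CplusA : associative Cplus. Proof. exact: Cplus_assoc. Qed.

HB.instance Definition _ :=
  Monoid.isComLaw.Build C (RtoC 0) Cplus CplusA Cplus_comm Cplus_0_l.

(** Membership is expressed by [List.In] because the index may be a character, that is, a function
    without decidable equality. *)
Lemma qexp_sum (I : Type) (s : seq I) (c : I -> nat -> C) (f : I -> C -> C) :
  (forall i, List.In i s -> qexp (c i) (f i)) ->
  qexp (fun n => \sum_(i <- s) c i n) (fun q => \sum_(i <- s) f i q).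
Proof.
elim: s => [|i s IH] H.
  move=> r /qexp_0; rewrite big_nil; apply: is_series_ext => n.
  by rewrite big_nil.
have Hi : qexp (c i) (f i) by apply: H; left.
have Hs := IH (fun j js => H j (or_intror js)).
move=> r /(qexp_plus _ _ _ _ Hi Hs); rewrite big_cons; apply: is_series_ext => n.
by rewrite big_cons.
Qed.

(** The dilated series has nonzero terms only at multiples of d, so its n-th partial sum at r is the
    (n / d)-th partial sum of the original series at r^d. *)
Lemma qexp_pow_dilate (c : nat -> C) f d : (0 < d)%N -> qexp c f ->
  qexp (fun n => if d %| n then c (n %/ d)%N else 0) (fun q => f (Cpow q d)).
Proof.
move=> d0 H r hr.
have hrd : (0 < Rabs (r ^ d) < 1)%Re.
  rewrite -RPow_abs; split; first by apply: pow_lt; lra.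
  by apply: (proj2 (pow_lt_1_compat _ _ _ _)); [lra | apply/ltP].
have := H _ hrd; rewrite -RtoC_pow.
set a := fun n => c n * _; set b := fun n => _ * _.
have e n : sum_n b n = sum_n a (n %/ d)%N.
  elim: n => [|n IH]; first by rewrite div0n !sum_O /a /b /= dvdn0 div0n.
  rewrite sum_Sn IH divnS // /b; case: ifP => [dvd_d|_].
    rewrite add1n sum_Sn /a; congr plus.
    have <- : (n.+1 %/ d)%N = (n %/ d).+1 by rewrite divnS // dvd_d.
    by rewrite -!RtoC_pow -pow_mult -[(d * _)%coq_nat]/(d * (n.+1 %/ d))%N mulnC divnK.
  by rewrite add0n Cmult_0_l; apply: Cplus_0_r.
move=> /filterlim_locally Ha; apply/filterlim_locally => eps.
have [N HN] := Ha eps; exists (N * d)%N => n /leP Nn.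
by rewrite e; apply: HN; apply/leP; rewrite leq_divRL.
Qed.

(** * Growth, products and uniqueness of q-expansions *)

Definition sextic_growth (a : nat -> R) : Prop :=
  exists M, forall n, (Rabs (a n) <= M * INR n.+1 ^ 6)%Re.

(** Comparison with the series of coefficients (n + 1)^6, whose radius of convergence is 1 by
    d'Alembert's criterion. *)
Lemma sextic_growth_series (a : nat -> R) r :
  sextic_growth a -> (Rabs r < 1)%Re ->
  ex_series (fun n => Rabs (a n * r ^ n)%Re).
Proof.
move=> [M Ha] r1.
pose b n := (INR n.+1 ^ 6)%Re.
have b0 n : (0 < b n)%Re by apply/pow_lt/lt_0_INR/ltP.
have : CV_disk b r.
  apply: (CV_disk_DAlembert _ _ 1) => [n||]; first by have := b0 n; lra.
    have lim : is_lim_seq (fun n => 1 + / INR n.+1)%Re 1%Re.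
      rewrite -{2}(Rplus_0_r 1); apply: is_lim_seq_plus'; first exact: is_lim_seq_const.
      apply: (is_lim_seq_inv _ p_infty) => //.
      exact/(is_lim_seq_incr_1 INR)/is_lim_seq_INR.
    (* The ratio of consecutive coefficients is ((n + 2) / (n + 1))^6 = (1 + 1 / (n + 1))^6. *)
    have lim6 : is_lim_seq (fun n => (1 + / INR n.+1) ^ 6)%Re (1 ^ 6)%Re.
      by do !apply: is_lim_seq_mult' => //; apply: is_lim_seq_const.
    rewrite pow1 in lim6; apply: is_lim_seq_ext lim6 => n.
    have n0 : (0 < INR n.+1)%Re by apply/lt_0_INR/ltP.
    rewrite Rabs_pos_eq /b; last by apply/Rlt_le/Rdiv_lt_0_compat; apply: b0.
    by rewrite (S_INR n.+1); field; lra.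
  by right; split; lra.
move=> /(ex_series_scal M) H; apply: ex_series_le H => n.
change (Rabs (Rabs (a n * r ^ n)) <= M * Rabs (b n * r ^ n))%Re.
rewrite Rabs_Rabsolu (Rabs_mult (a n)) (Rabs_mult (b n)).
rewrite (Rabs_pos_eq (b n)); last exact/Rlt_le/b0.
by rewrite -Rmult_assoc; apply: Rmult_le_compat_r; [apply: Rabs_pos | apply: Ha].
Qed.

Lemma qexp_qseries (c : nat -> C) (a : nat -> R) :
  (forall n, c n = RtoC (a n)) -> a 0%N = 0%Re -> sextic_growth a ->
  qexp c (qseries c).
Proof.
move=> ca a0 Ha r [_ r1].
have [l Hl] : ex_series (fun n => a n * r ^ n)%Re.
  exact/ex_series_Rabs/sextic_growth_series.
have HC : is_Cseries (fun n => c n * Cpow (RtoC r) n) (RtoC l).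
  have := is_Cseries_RtoC _ _ Hl.
  by apply: is_series_ext => n; rewrite ca RtoC_mult RtoC_pow.
rewrite (qseriesE c (RtoC r) (RtoC l)) //.
apply: (is_series_incr_1 (fun n => c n * Cpow (RtoC r) n)).
rewrite ca a0 Cmult_0_l; have -> // : plus (RtoC l) (RtoC 0) = RtoC l.
exact: Cplus_0_r.
Qed.

(** With real coefficients and real r both values are real, so the Cauchy product theorem for
    absolutely convergent real series applies. *)
Lemma qexp_mult (a b : nat -> R) f g :
  sextic_growth a -> sextic_growth b ->
  qexp (fun n => RtoC (a n)) f -> qexp (fun n => RtoC (b n)) g ->
  qexp (fun n => RtoC (PS_mult a b n)) (fun q => f q * g q).
Proof.
move=> Ha Hb Hf Hg r hr.
have real c h : qexp (fun n => RtoC (c n)) h ->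
    exists2 l, h (RtoC r) = RtoC l & is_series (fun n => c n * r ^ n)%Re l.
  move=> /(_ r hr) H; have {}H : is_Cseries (fun n => RtoC (c n * r ^ n)%Re) (h (RtoC r)).
    by apply: is_series_ext H => n; rewrite RtoC_mult RtoC_pow.
  exists (Re (h (RtoC r))); last exact: (is_Cseries_Re _ _ H).
  exact: (is_Cseries_unique _ _ _ H (is_Cseries_RtoC _ _ (is_Cseries_Re _ _ H))).
have [la -> Hla] := real _ _ Hf; have [lb -> Hlb] := real _ _ Hg.
have := is_series_mult _ _ _ _ Hla Hlb 
  (sextic_growth_series _ _ Ha hr.2) (sextic_growth_series _ _ Hb hr.2).
move=> /is_Cseries_RtoC; rewrite RtoC_mult; apply: is_series_ext => n.
rewrite -RtoC_pow -RtoC_mult /PS_mult; congr RtoC.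
rewrite [RHS]Rmult_comm scal_sum; apply: PartSum.sum_eq => k kn; cbv beta.
have -> : (r ^ n = r ^ k * r ^ (n - k)%coq_nat)%Re.
  by rewrite -pow_add; congr pow; lia.
ring.
Qed.

(** The real and imaginary parts of the difference are real power series vanishing on the punctured
    interval 0 < |r| < 1; continuity at 0 fills the gap, and a power series vanishing near 0 has
    zero coefficients. *)
Lemma qexp_unique (c d : nat -> C) f : qexp c f -> qexp d f -> c =1 d.
Proof.
move=> Hc Hd.
have real (a : nat -> R) : (forall r, 0 < Rabs r < 1 ->
    is_series (fun n => a n * r ^ n) 0)%Re -> forall n, a n = 0%Re.
  move=> Ha n.
  (* Convergence at 1/2 already bounds the radius from below. *)
  have rad : Rbar_lt 0 (CV_radius a).
    apply: (Rbar_lt_le_trans _ (Rbar.Finite (1 / 2)%Re)); first by rewrite /=; lra.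
    apply: Rbar_not_lt_le => lt.
    have h2 : (Rabs (1 / 2) = 1 / 2)%Re by rewrite Rabs_pos_eq; lra.
    apply: (CV_disk_outside a (1 / 2)%Re); first by rewrite h2.
    apply: ex_series_lim_0; exists 0%Re; apply: Ha; lra.
  have van r : (0 < Rabs r < 1)%Re -> PSeries a r = 0%Re.
    by move=> /Ha /is_pseries_R; apply: is_pseries_unique.
  apply: (PSeries_ext_recip a (fun=> 0%Re)) => //; first by rewrite CV_radius_const_0.
  exists (mkposreal _ Rlt_0_1) => x.
  rewrite /ball /= /AbsRing_ball /abs /minus /plus /opp /= Ropp_0 Rplus_0_r => x1.
  rewrite PSeries_const_0.
  case: (Req_dec x 0) => [->|x0]; last by apply: van; split=> //; apply: Rabs_pos_lt.
  case: (Req_dec (PSeries a 0) 0) => // /Rabs_pos_lt pos.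
  have := PSeries_continuity a 0; rewrite Rabs_R0.
  move=> /(_ rad) /(_ _ pos) [delta [d0 Hdelta]].
  (* A point of the punctured interval within [delta] of 0: the series vanishes there, although
     continuity keeps it closer to its value at 0 than the modulus of that value. *)
  pose m := (Rmin delta 1 / 2)%Re.
  have m0 : (0 < m < delta /\ m < 1)%Re.
    have := Rmin_l delta 1; have := Rmin_r delta 1.
    have : (0 < Rmin delta 1)%Re by apply: Rmin_glb_lt; lra.
    by rewrite /m; lra.
  have am : Rabs m = m by apply: Rabs_pos_eq; lra.
  have : (Rabs (PSeries a m - PSeries a 0) < Rabs (PSeries a 0))%Re.
    apply: (Hdelta m); split; first by split=> //; lra.
    by rewrite /= /Rdist Rminus_0_r am; lra.
  by rewrite van ?am ?Rminus_0_l ?Rabs_Ropp; lra.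
have H0 r : (0 < Rabs r < 1)%Re ->
    is_Cseries (fun n => (c n - d n) * Cpow (RtoC r) n) 0.
  move=> hr; have := qexp_plus _ _ _ _ Hc (qexp_scal (- (1)) _ _ Hd) r hr.
  rewrite (_ : _ + _ = 0); last ring.
  by apply: is_series_ext => n; congr (_ * _); ring.
have e n r : (c n - d n) * Cpow (RtoC r) n =
    (Re (c n - d n) * r ^ n, Im (c n - d n) * r ^ n)%Re.
  by rewrite -RtoC_pow; apply: injective_projections => /=; ring.
move=> n; have re : Re (c n - d n) = 0%Re.
  apply: (real (fun n => Re (c n - d n))) => r /H0 /is_Cseries_Re.
  by apply: is_series_ext => k; rewrite e.
have im : Im (c n - d n) = 0%Re.
  apply: (real (fun n => Im (c n - d n))) => r /H0 /is_Cseries_Im.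
  by apply: is_series_ext => k; rewrite e.
have /(f_equal (fun x => x + d n)) : c n - d n = 0 by apply: injective_projections.
by rewrite Cplus_0_l => <-; ring.
Qed.

(** The nome of x + i y has modulus exp(-2 pi y) and argument 2 pi x. Solving for the modulus gives
    y, while x = 0 or x = 1/2 gives the sign. *)
Lemma nome_real r : (0 < Rabs r < 1)%Re ->
  exists2 z, upper_half_plane z & nome z = RtoC r.
Proof.
move=> [r0 r1]; pose y := (- ln (Rabs r) / (2 * PI))%Re.
have pi0 := PI_RGT_0.
have y0 : (0 < y)%Re.
  apply: Rdiv_lt_0_compat; last lra.
  by have := ln_increasing _ _ r0 r1; rewrite ln_1; lra.
have e x : nome (x, y) = RtoC (Rabs r) * (cos (2 * PI * x), sin (2 * PI * x)).
  rewrite /nome /Cexp.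
  have -> : 2 * PI * Ci * (x, y) = (- (2 * PI * y), 2 * PI * x)%Re.
    by apply: injective_projections => /=; ring.
  rewrite /=; have -> // : (- (2 * PI * y) = ln (Rabs r))%Re by rewrite /y; field; lra.
  by rewrite exp_ln.
case: (Rcase_abs r) => hr.
  exists (1 / 2, y)%Re => //; rewrite e.
  rewrite (_ : (2 * PI * (1 / 2) = PI)%Re); last by field.
  rewrite cos_PI sin_PI Rabs_left //.
  by apply: injective_projections => /=; ring.
exists (0%Re, y) => //; rewrite e Rmult_0_r cos_0 sin_0 Rabs_right //.
by apply: injective_projections => /=; ring.
Qed.

Lemma qexp_eq_on (c : nat -> C) f g :
  (forall r, (0 < Rabs r < 1)%Re -> f (RtoC r) = g (RtoC r)) ->
  qexp c f -> qexp c g.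
Proof. by move=> e H r hr; rewrite -e //; apply: H. Qed.

Lemma sextic_growth_plus (a b : nat -> R) :
  sextic_growth a -> sextic_growth b ->
  sextic_growth (fun n => a n + b n)%Re.
Proof.
move=> [M Ha] [N Hb]; exists (M + N)%Re => n.
have := Rabs_triang (a n) (b n); have := Ha n; have := Hb n; lra.
Qed.

Lemma sextic_growth_mul_bounded (u a : nat -> R) K :
  (forall n, Rabs (u n) <= K)%Re -> sextic_growth a ->
  sextic_growth (fun n => u n * a n)%Re.
Proof.
move=> Hu [M Ha]; exists (K * M)%Re => n.
rewrite Rabs_mult Rmult_assoc; apply: Rmult_le_compat => //; exact: Rabs_pos.
Qed.

(** * Coefficients of the Eisenstein series and of their products *)

Lemma sigma0 k : sigma k 0 = 0%N.
Proof. by rewrite /sigma big_geq. Qed.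

Lemma sigma_frac0 k d : sigma_frac k 0 d = 0%N.
Proof. by rewrite /sigma_frac dvdn0 div0n sigma0. Qed.

Lemma INR_expn m k : INR (m ^ k)%N = (INR m ^ k)%Re.
Proof. by elim: k => //= k IH; rewrite expnS mult_INR IH. Qed.

(** There are at most n / d divisors to sum over, each contributing at most (n + 1)^5; this is where
    the exponent 6 comes from. *)
Lemma sigma_frac_growth k d : (k <= 5)%N ->
  sextic_growth (fun n => INR (sigma_frac k n d)).
Proof.
move=> k5; exists 1%Re => n.
rewrite Rabs_pos_eq; last exact: pos_INR.
rewrite Rmult_1_l -INR_expn; apply/le_INR/leP.
rewrite /sigma_frac; case: ifP => // _.
apply: (@leq_trans (n %/ d * n.+1 ^ 5)%N); last first.
  by rewrite [(_ ^ 6)%N]expnS leq_mul // (leq_trans (leq_div _ _)).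
rewrite -[X in (_ <= X * _)%N](@subn1 (n %/ d).+1) -sum_nat_const_nat.
rewrite /sigma big_mkcond big_seq [X in (_ <= X)%N]big_seq.
apply: leq_sum => m; rewrite mem_index_iota => /andP[m0 mn]; case: ifP => // _.
have mn1 : (m <= n.+1)%N by apply: leq_trans (leq_trans mn _); rewrite ?ltnS ?leq_div.
apply: (@leq_trans (n.+1 ^ k)%N); first by case: (k) => // k'; rewrite leq_exp2r.
by rewrite leq_pexp2l.
Qed.

(** Every factor is -1, 0 or 1, and absolute value at most 1 is stable under products and powers.
    Twisting by a character therefore preserves sextic growth. *)
Lemma kronecker_bound m n : (Rabs (IZR (kronecker m n)) <= 1)%Re.
Proof.
pose U (z : Z) := (Z.abs z <= 1)%Z.
have U1 : U 1%Z by [].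
have UM x y : U x -> U y -> U (x * y)%Z by rewrite /U; nia.
have UX x (k : nat) : U x -> U (x ^ Z.of_nat k)%Z.
  move=> Ux; elim: k => [//|k IH].
  by rewrite Nat2Z.inj_succ Z.pow_succ_r; [apply: UM | lia].
suff H : U (kronecker m n) by rewrite -abs_IZR; apply: IZR_le.
rewrite /kronecker; case: ifP => _; first by case: ifP.
apply: (UM _ _); first by case: ifP.
elim/big_ind: _ => // p _; apply: UX; rewrite /prime_symbol.
by do !case: ifP => _.
Qed.

Lemma INR_sum n (F : nat -> nat) :
  INR (\sum_(0 <= m < n.+1) F m)%N = sum_f_R0 (fun m => INR (F m)) n.
Proof.
elim: n => [|n IH]; first by rewrite big_nat1.
by rewrite big_nat_recr //= plus_INR IH.
Qed.

Definition one_coef (n : nat) : R := if n == 0%N then 1%Re else 0%Re.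

(** The coefficients of 1 + K sum_m sigma_k(m) q^(d m): E_2, E_4 and E_6 at q^d for (K, k) = (-24,
    1), (240, 3) and (-504, 5). *)
Definition eis_coef (K : R) (k d n : nat) : R :=
  (one_coef n + K * INR (sigma_frac k n d))%Re.

Lemma eis_coef_growth K k d : (k <= 5)%N -> sextic_growth (eis_coef K k d).
Proof.
move=> k5; apply: sextic_growth_plus.
  exists 1%Re => n; rewrite Rmult_1_l.
  apply: (Rle_trans _ 1); first by rewrite /one_coef; case: eqP => _; split_Rabs; lra.
  by apply: pow_R1_Rle; apply: (le_INR 1); lia.
apply: (sextic_growth_mul_bounded _ _ (Rabs K)) => [n|]; first lra.
exact: sigma_frac_growth.
Qed.

Lemma qexp_eis K k d : (0 < d)%N -> (k <= 5)%N ->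
  qexp (fun n => RtoC (eis_coef K k d n))
    (fun q => 1 + RtoC K * qseries (fun n => (sigma k n)%:C) (Cpow q d)).
Proof.
move=> d0 k5.
have H : qexp (fun n => (sigma k n)%:C) (qseries (fun n => (sigma k n)%:C)).
  apply: (qexp_qseries _ (fun n => INR (sigma_frac k n 1))) => [n||].
  - by rewrite sigma_frac1.
  - by rewrite sigma_frac0.
  - exact: sigma_frac_growth.
have := qexp_plus _ _ _ _ qexp_1 (qexp_scal (RtoC K) _ _ (qexp_pow_dilate _ _ d d0 H)).
apply: qexp_ext => n; rewrite /eis_coef RtoC_plus RtoC_mult /one_coef /sigma_frac.
by congr (_ + _ * _); [case: eqP | case: ifP].
Qed.

Lemma qexp_E2 d : (0 < d)%N ->
  qexp (fun n => RtoC (eis_coef (-24) 1 d n)) (fun q => E2 (Cpow q d)).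
Proof.
move=> d0; apply: qexp_eq_on (qexp_eis (-24) 1 d d0 _) => // r _.
by rewrite /E2; ring.
Qed.

Lemma qexp_E4 d : (0 < d)%N ->
  qexp (fun n => RtoC (eis_coef 240 3 d n)) (fun q => E4 (Cpow q d)).
Proof. by move=> d0; apply: qexp_eis. Qed.

Lemma qexp_E6 d : (0 < d)%N ->
  qexp (fun n => RtoC (eis_coef (-504) 5 d n)) (fun q => E6 (Cpow q d)).
Proof.
move=> d0; apply: qexp_eq_on (qexp_eis (-504) 5 d d0 _) => // r _.
by rewrite /E6; ring.
Qed.

Lemma sum_f_R0_first (F : nat -> R) n :
  (forall m, (0 < m)%N -> F m = 0%Re) -> sum_f_R0 F n = F 0%N.
Proof. move=> H; elim: n => //= n ->; by rewrite (H n.+1) ?Rplus_0_r. Qed.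

Lemma sum_f_R0_last (F : nat -> R) n :
  (forall m, (m < n)%N -> F m = 0%Re) -> sum_f_R0 F n = F n.
Proof.
case: n => // n H; rewrite /= sum_eq_R0 ?Rplus_0_l // => m /leP mn.
by apply: H.
Qed.

Lemma PS_mult_eis K i a L j b n : (0 < a)%N -> (0 < b)%N -> (0 < n)%N ->
  PS_mult (eis_coef K i a) (eis_coef L j b) n =
  (K * INR (sigma_frac i n a) + L * INR (sigma_frac j n b)
   + K * L * INR (W i j a b n))%Re.
Proof.
move=> a0 b0 n0; rewrite W_convolution // INR_sum.
pose F1 m := (L * (one_coef m * INR (sigma_frac j (n - m) b)))%Re.
pose F2 m := (K * (INR (sigma_frac i m a) * one_coef (n - m)))%Re.
rewrite scal_sum /PS_mult.
have e1 : (L * INR (sigma_frac j n b))%Re = sum_f_R0 F1 n.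
  rewrite sum_f_R0_first /F1 /one_coef => [|[]//]; last by move=> m _ /=; ring.
  by rewrite /= subn0; ring.
have e2 : (K * INR (sigma_frac i n a))%Re = sum_f_R0 F2 n.
  rewrite sum_f_R0_last /F2 /one_coef => [|m mn]; first by rewrite subnn /=; ring.
  by rewrite subn_eq0 leqNgt mn /=; ring.
rewrite e1 e2 -!sum_plus; apply: PartSum.sum_eq => m mn; cbv beta.
rewrite mult_INR /F1 /F2 /eis_coef -[(n - m)%coq_nat]/(n - m)%N.
(* The product of the two constant terms contributes nothing, since m and n - m are not both 0 when
   n > 0. *)
have e0 : (one_coef m * one_coef (n - m) = 0)%Re.
  rewrite /one_coef subn_eq0; case: (eqVneq m 0%N) => [->|_]; last by ring.
  by rewrite leqNgt n0 /=; ring.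
rewrite -[RHS]Rplus_0_l -e0; ring.
Qed.

(** * Comparison of coefficients in the basis *)

Lemma In_mem (T : eqType) (x : T) (s : seq T) : List.In x s -> x \in s.
Proof.
elim: s => //= y s IH [->|/IH xs]; rewrite in_cons ?eqxx // xs orbT.
by [].
Qed.

(** The decomposition holds at every z, hence, by [nome_real], at every real q with 0 < |q| < 1.
    Every basis element has a q-expansion there, so [qexp_unique] applies. *)
Lemma BM_coefE (N : nat) (B : BM_data) (F : C -> C) (X : nat -> C)
    (Zc : (Z -> C) -> nat -> C) (Y : nat -> C) (c : nat -> C) (n : nat) :
  (0 < N)%N -> is_BM_basis N B -> coefficients_in_BM N B F X Zc Y ->
  qexp c F -> (0 < n)%N ->
  c n = - (504) * \sum_(delta <- divisors N) (X delta * (sigma_frac 5 n delta)%:C)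
    + \sum_(chi <- chars B) \sum_(s <- Dchi B chi)
        (Zc chi s * chi (Z.of_nat n) * (sigma_frac 5 n s)%:C)
    + \sum_(1 <= j < (mS B).+1) (Y j * cuspb B j n).
Proof.
move=> N0 [_ [Hchars [_ [Hcusp _]]]] HF Hc n0.
have divN0 s : s \in divisors N -> (0 < s)%N.
  by rewrite -dvdn_divisors // => /dvdn_gt0; apply.
have HE6 := qexp_sum _ (divisors N) _ _ (fun delta h =>
  qexp_scal (X delta) _ _ (qexp_E6 delta (divN0 _ (In_mem _ _ _ h)))).
have Hchi chi s : List.In chi (chars B) -> List.In s (Dchi B chi) ->
    qexp (fun n => Zc chi s * (chi (Z.of_nat n) * (sigma_frac 5 n s)%:C))
      (fun q => Zc chi s * E6chi chi s q).
  move=> /Hchars[[_ [m Hm]] _ sub] /In_mem/sub/divN0 s0; apply: qexp_scal.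
  apply: (qexp_qseries _
    (fun n => IZR (kronecker m (Z.of_nat n)) * INR (sigma_frac 5 n s))%Re).
  - by move=> k; rewrite Hm RtoC_mult.
  - by rewrite sigma_frac0 Rmult_0_r.
  - apply: sextic_growth_mul_bounded (sigma_frac_growth _ _ _) => // k.
    exact: kronecker_bound.
have HE6chi := qexp_sum _ (chars B) _ _ (fun chi hchi =>
  qexp_sum _ (Dchi B chi) _ _ (fun s hs => Hchi chi s hchi hs)).
(* The cusp forms are given as functions of z; their Fourier series provide the functions of q that
   [qexp] requires. *)
have Hcuspq j z : (1 <= j <= mS B)%N -> upper_half_plane z ->
    qseries (cuspb B j) (nome z) = cuspB B j z.
  by move=> hj hz; apply: qseriesE; apply: Hcusp.
(* The Fourier series starts at n = 1, so the constant coefficient is set to 0 instead of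
   [cuspb B j 0]. *)
have HB j : List.In j (index_iota 1 (mS B).+1) ->
    qexp (fun n => Y j * (if n == 0%N then RtoC 0 else cuspb B j n))
      (fun q => Y j * qseries (cuspb B j) q).
  move=> /In_mem; rewrite mem_index_iota ltnS => hj; apply: qexp_scal => r hr.
  have [z hz <-] := nome_real r hr; rewrite Hcuspq //.
  apply: is_series_decr_1; rewrite Cmult_0_l.
  have -> : plus (cuspB B j z) (opp (RtoC 0)) = cuspB B j z.
    by change (cuspB B j z + - RtoC 0 = cuspB B j z); ring.
  exact: Hcusp.
have HYB := qexp_sum _ (index_iota 1 (mS B).+1) _ _ HB.
have /qexp_eq_on Hrhs := qexp_plus _ _ _ _ (qexp_plus _ _ _ _ HE6 HE6chi) HYB.
refine (eq_trans (qexp_unique _ _ _ Hc (Hrhs _ _) n) _) => [r hr|].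
  have [z hz ez] := nome_real r hr.
  rewrite -ez (HF z hz); congr (_ + _).
  rewrite big_seq [RHS]big_seq; apply: eq_bigr => j.
  by rewrite mem_index_iota ltnS => hj; rewrite Hcuspq.
rewrite (gtn_eqF n0); congr (_ + _ + _).
  have CmulDr : right_distributive Cmult Cplus := Cmult_plus_distr_l.
  rewrite (big_morph (Cmult (- (504))) (CmulDr _) (Cmult_0_r _)).
  apply: eq_bigr => delta _.
  by rewrite /eis_coef /one_coef (gtn_eqF n0) Rplus_0_l RtoC_mult; ring.
by apply: eq_bigr => chi _; apply: eq_bigr => s _; rewrite Cmult_assoc.
Qed.

(** * Elimination of the diagonal convolution and the four formulas *)

Lemma natC_add m n : (m + n)%N%:C = m%:C + n%:C.
Proof. by rewrite plus_INR RtoC_plus. Qed.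

Lemma natC_mul m n : (m * n)%N%:C = m%:C * n%:C.
Proof. by rewrite mult_INR RtoC_mult. Qed.

Lemma natC_Z (m : nat) : m%:C = RtoC (IZR (Z.of_nat m)).
Proof. by rewrite INR_IZR_INZ. Qed.

(** This is [W_11] at m = n / a multiplied by a, so that a m becomes n and no quotient remains. If a
    does not divide n, every term vanishes. *)
Lemma W_diag a n : (0 < a)%N -> (0 < n)%N ->
  (240 * (a * W 1 3 a a n) + 30 * (n * sigma_frac 3 n a) +
     a * sigma_frac 1 n a =
   21 * (a * sigma_frac 5 n a) + 10 * (a * sigma_frac 3 n a))%N.
Proof.
move=> a0 n0; rewrite W_dilate // /sigma_frac; case: ifP => [/dvdnP[m e]|_].
  by rewrite e mulnK //; have := W_11 m; rewrite e in n0; nia.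
by rewrite !muln0.
Qed.

Lemma W_diagC a n : (0 < a)%N -> (0 < n)%N ->
  a%:C * (W 1 3 a a n)%:C =
  1 / 240 * (21 * (a%:C * (sigma_frac 5 n a)%:C)
    + 10 * (a%:C * (sigma_frac 3 n a)%:C)
    - 30 * (n%:C * (sigma_frac 3 n a)%:C)
    - a%:C * (sigma_frac 1 n a)%:C).
Proof.
move=> a0 n0; have := f_equal (fun k => k%:C) (W_diag a n a0 n0).
rewrite !(natC_add, natC_mul).
rewrite (natC_Z 240) (natC_Z 30) (natC_Z 21) (natC_Z 10) /= => e.
transitivity (1 / 240 * (240 * (a%:C * (W 1 3 a a n)%:C))); first by field.
congr (_ * _); set w := 240 * _ in e *.
rewrite (_ : w = w + 30 * (n%:C * (sigma_frac 3 n a)%:C)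
  + a%:C * (sigma_frac 1 n a)%:C - 30 * (n%:C * (sigma_frac 3 n a)%:C)
  - a%:C * (sigma_frac 1 n a)%:C); last by ring.
by rewrite e; ring.
Qed.

(* The n-th coefficient, for n > 0, of E_2(q^a) E_4(q^b). *)
Definition E2E4_coef a b n : C :=
  240 * (sigma_frac 3 n b)%:C - 24 * (sigma_frac 1 n a)%:C
  - 5760 * (W 1 3 a b n)%:C.

Lemma qexp_E2E4 a b : (0 < a)%N -> (0 < b)%N ->
  exists2 c, qexp c (fun q => E2 (Cpow q a) * E4 (Cpow q b)) &
    forall n, (0 < n)%N -> c n = E2E4_coef a b n.
Proof.
move=> a0 b0; have g1 := eis_coef_growth (-24) 1 a erefl.
have g3 := eis_coef_growth 240 3 b erefl.
have H := qexp_mult _ _ _ _ g1 g3 (qexp_E2 a a0) (qexp_E4 b b0).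
exists (fun n => RtoC (PS_mult (eis_coef (-24) 1 a) (eis_coef 240 3 b) n)) => //.
move=> n n0; rewrite PS_mult_eis //.
have e K L x y w : RtoC (K * x + L * y + K * L * w)%Re =
    RtoC K * RtoC x + RtoC L * RtoC y + RtoC K * RtoC L * RtoC w.
  by rewrite !RtoC_plus !RtoC_mult.
by rewrite e /E2E4_coef; ring.
Qed.

Lemma sum_divisors_split N d (F : nat -> C) : (0 < N)%N -> d %| N ->
  \sum_(delta <- divisors N) F delta =
  F d + \sum_(delta <- divisors N | delta != d) F delta.
Proof.
by move=> N0 dN; rewrite (bigD1_seq d) ?divisors_uniq -?dvdn_divisors.
Qed.

Lemma natC_neq0 a : (0 < a)%N -> a%:C <> 0.
Proof.
move=> a0 /(f_equal Re) /=; apply: not_eq_sym; apply: Rlt_not_eq.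
exact/lt_0_INR/ltP.
Qed.

(** Covers all four functions of the theorem at once; d is the divisor whose term the final formula
    displays separately, 1 or N. *)
Lemma E2E4_comb_coefE (N a b a' b' : nat) (u v : C) (B : BM_data) (F : C -> C)
    (X : nat -> C) (Zc : (Z -> C) -> nat -> C) (Y : nat -> C) (n d : nat) :
  (0 < N)%N -> (0 < a)%N -> (0 < b)%N -> (0 < a')%N -> (0 < b')%N ->
  is_BM_basis N B -> coefficients_in_BM N B F X Zc Y ->
  (forall q, u * (E2 (Cpow q a) * E4 (Cpow q b)) +
             v * (E2 (Cpow q a') * E4 (Cpow q b')) = F q) ->
  (0 < n)%N -> d %| N ->
  u * E2E4_coef a b n + v * E2E4_coef a' b' n =
  - (504) * (X d * (sigma_frac 5 n d)%:C
     + \sum_(delta <- divisors N | delta != d) (X delta * (sigma_frac 5 n delta)%:C))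
    + \sum_(chi <- chars B) \sum_(s <- Dchi B chi)
        (Zc chi s * chi (Z.of_nat n) * (sigma_frac 5 n s)%:C)
    + \sum_(1 <= j < (mS B).+1) (Y j * cuspb B j n).
Proof.
move=> N0 a0 b0 a'0 b'0 HB HF eF n0 dN.
have [c Hc ec] := qexp_E2E4 a b a0 b0.
have [c' Hc' ec'] := qexp_E2E4 a' b' a'0 b'0.
have /(qexp_eq_on _ _ F) H :=
  qexp_plus _ _ _ _ (qexp_scal u _ _ Hc) (qexp_scal v _ _ Hc').
have {}H := H (fun r _ => eF (RtoC r)).
rewrite -ec // -ec' // (BM_coefE _ _ _ _ _ _ _ n N0 HB HF H n0).
by rewrite -sum_divisors_split.
Qed.

(** Linear elimination by certificate: w is the wanted convolution sum, L = R the comparison of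
    coefficients and L' = R' the value of the diagonal sum. The last hypothesis is left to
    [field]. *)
Lemma eq_of_linear_comb (k m w e L R L' R' : C) :
  k <> 0 -> L = R -> L' = R' ->
  k * (w - e) = R - L + m * (R' - L') -> w = e.
Proof.
move=> k0 -> -> H.
have {}H : k * (w - e) = 0 by rewrite H; ring.
have : w - e = 0.
  by rewrite -(Cmult_1_l (w - e)) -(Cinv_l k k0) -Cmult_assoc H Cmult_0_r.
by move=> E; rewrite -(Cplus_0_l e) -E; ring.
Qed.

Theorem theorem3p6 (n : nat) (hn : (0 < n)%N) :
  (forall (alpha : nat) (B : BM_data) (X : nat -> C)
      (Zc : (Z -> C) -> nat -> C) (Y : nat -> C),
    (1 < alpha)%N -> is_BM_basis alpha B ->
    coefficients_in_BM alpha B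
      (fun q => (alpha%:C * E2 (Cpow q alpha) - E2 q) * E4 q) X Zc Y ->
    (W 1 3 alpha 1 n)%:C =
      7 / (80 * alpha%:C) * (1 + X 1%N) * (sigma 5 n)%:C
      + 1 / 24 * (sigma 3 n)%:C
      - 1 / (8 * alpha%:C) * n%:C * (sigma 3 n)%:C
      - 1 / 240 * (sigma_frac 1 n alpha)%:C
      + 7 / (80 * alpha%:C) *
          \sum_(delta <- divisors alpha | delta != 1%N)
            (X delta * (sigma_frac 5 n delta)%:C)
      - 1 / (5760 * alpha%:C) *
          \sum_(1 <= j < (mS B).+1) (Y j * cuspb B j n)
      - 1 / (5760 * alpha%:C) *
          \sum_(chi <- chars B) \sum_(s <- Dchi B chi)
            (Zc chi s * chi (Z.of_nat n) * (sigma_frac 5 n s)%:C)) /\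
  (forall (beta : nat) (B : BM_data) (X : nat -> C)
      (Zc : (Z -> C) -> nat -> C) (Y : nat -> C),
    (1 < beta)%N -> is_BM_basis beta B ->
    coefficients_in_BM beta B
      (fun q => E4 q * (E2 q - beta%:C * E2 (Cpow q beta))) X Zc Y ->
    (W 3 1 1 beta n)%:C =
      7 / (80 * beta%:C) * (1 - X 1%N) * (sigma 5 n)%:C
      + 1 / 24 * (sigma 3 n)%:C
      - 1 / (8 * beta%:C) * n%:C * (sigma 3 n)%:C
      - 1 / 240 * (sigma_frac 1 n beta)%:C
      - 7 / (80 * beta%:C) *
          \sum_(delta <- divisors beta | delta != 1%N)
            (X delta * (sigma_frac 5 n delta)%:C)
      + 1 / (5760 * beta%:C) *
          \sum_(1 <= j < (mS B).+1) (Y j * cuspb B j n)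
      + 1 / (5760 * beta%:C) *
          \sum_(chi <- chars B) \sum_(s <- Dchi B chi)
            (Zc chi s * chi (Z.of_nat n) * (sigma_frac 5 n s)%:C)) /\
  (forall (beta : nat) (B : BM_data) (X : nat -> C)
      (Zc : (Z -> C) -> nat -> C) (Y : nat -> C),
    (1 < beta)%N -> is_BM_basis beta B ->
    coefficients_in_BM beta B
      (fun q => (beta%:C * E2 (Cpow q beta) - E2 q) * E4 (Cpow q beta)) X Zc Y ->
    (W 1 3 1 beta n)%:C =
      7 / 80 * (beta%:C - X beta) * (sigma_frac 5 n beta)%:C
      + 1 / 24 * (sigma_frac 3 n beta)%:C
      - 1 / 8 * n%:C * (sigma_frac 3 n beta)%:C
      - 1 / 240 * (sigma 1 n)%:C
      - 7 / 80 *
          \sum_(delta <- divisors beta | delta != beta)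
            (X delta * (sigma_frac 5 n delta)%:C)
      + 1 / 5760 *
          \sum_(1 <= j < (mS B).+1) (Y j * cuspb B j n)
      + 1 / 5760 *
          \sum_(chi <- chars B) \sum_(s <- Dchi B chi)
            (Zc chi s * chi (Z.of_nat n) * (sigma_frac 5 n s)%:C)) /\
  (forall (alpha : nat) (B : BM_data) (X : nat -> C)
      (Zc : (Z -> C) -> nat -> C) (Y : nat -> C),
    (1 < alpha)%N -> is_BM_basis alpha B ->
    coefficients_in_BM alpha B
      (fun q => E4 (Cpow q alpha) * (E2 q - alpha%:C * E2 (Cpow q alpha)))
      X Zc Y ->
    (W 3 1 alpha 1 n)%:C =
      7 / 80 * (alpha%:C + X alpha) * (sigma_frac 5 n alpha)%:C
      + 1 / 24 * (sigma_frac 3 n alpha)%:C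
      - 1 / 8 * n%:C * (sigma_frac 3 n alpha)%:C
      - 1 / 240 * (sigma 1 n)%:C
      + 7 / 80 *
          \sum_(delta <- divisors alpha | delta != alpha)
            (X delta * (sigma_frac 5 n delta)%:C)
      - 1 / 5760 *
          \sum_(1 <= j < (mS B).+1) (Y j * cuspb B j n)
      - 1 / 5760 *
          \sum_(chi <- chars B) \sum_(s <- Dchi B chi)
            (Zc chi s * chi (Z.of_nat n) * (sigma_frac 5 n s)%:C)).
Proof.
have Cpow1 q : Cpow q 1 = q by rewrite /= Cmult_1_r.
have Cm5760 : RtoC (-5760) <> 0 by move=> /RtoC_inj; lra.
have C5760 : RtoC 5760 <> 0 by move=> /RtoC_inj; lra.
split; [|split; [|split]] => N B X Zc Y N1 HB HF;
  have N0 : (0 < N)%N by [apply: ltnW];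
  have NC := natC_neq0 _ N0.
- have eF q : N%:C * (E2 (Cpow q N) * E4 (Cpow q 1)) +
      - (1) * (E2 (Cpow q 1) * E4 (Cpow q 1)) =
      (N%:C * E2 (Cpow q N) - E2 q) * E4 q by rewrite Cpow1; ring.
  have := E2E4_comb_coefE N N 1 1 1 _ _ _ _ _ _ _ n 1
    N0 N0 erefl erefl erefl HB HF eF hn (dvd1n N).
  have := W_diagC 1 n erefl hn; rewrite /E2E4_coef !sigma_frac1 !Cmult_1_l => H' H.
  (* The unknown W enters R - L with factor 5760 N and the diagonal sum with factor -5760; the
     multiplier -5760 removes the latter. The other three cases differ in signs and in the place of
     N. *)
  apply: (eq_of_linear_comb (5760 * N%:C) (-5760) _ _ _ _ _ _ _ H H').
    exact: Cmult_neq_0.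
  by field.
- have eF q : - N%:C * (E2 (Cpow q N) * E4 (Cpow q 1)) +
      1 * (E2 (Cpow q 1) * E4 (Cpow q 1)) =
      E4 q * (E2 q - N%:C * E2 (Cpow q N)) by rewrite Cpow1; ring.
  have := E2E4_comb_coefE N N 1 1 1 _ _ _ _ _ _ _ n 1
    N0 N0 erefl erefl erefl HB HF eF hn (dvd1n N).
  have := W_diagC 1 n erefl hn; rewrite /E2E4_coef !sigma_frac1 !Cmult_1_l => H' H.
  (* The product of E_2 and E_4 involves only W^{1,3}; exchanging the two indices together with
     alpha and beta reduces W^{3,1} to it. *)
  rewrite W_comm.
  apply: (eq_of_linear_comb (-5760 * N%:C) 5760 _ _ _ _ _ _ _ H H').
    exact: Cmult_neq_0.
  by field.
(* The diagonal product is now the one with a = b = N, and the divisor singled out is N. *)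
- have eF q : N%:C * (E2 (Cpow q N) * E4 (Cpow q N)) +
      - (1) * (E2 (Cpow q 1) * E4 (Cpow q N)) =
      (N%:C * E2 (Cpow q N) - E2 q) * E4 (Cpow q N) by rewrite Cpow1; ring.
  have := E2E4_comb_coefE N N N 1 N _ _ _ _ _ _ _ n N
    N0 N0 N0 erefl N0 HB HF eF hn (dvdnn N).
  have := W_diagC N n N0 hn; rewrite /E2E4_coef !sigma_frac1 => H' H.
  apply: (eq_of_linear_comb (-5760) 5760 _ _ _ _ _ _ _ H H').
    exact: Cm5760.
  by field.
- have eF q : - N%:C * (E2 (Cpow q N) * E4 (Cpow q N)) +
      1 * (E2 (Cpow q 1) * E4 (Cpow q N)) =
      E4 (Cpow q N) * (E2 q - N%:C * E2 (Cpow q N)) by rewrite Cpow1; ring.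
  have := E2E4_comb_coefE N N N 1 N _ _ _ _ _ _ _ n N
    N0 N0 N0 erefl N0 HB HF eF hn (dvdnn N).
  have := W_diagC N n N0 hn; rewrite /E2E4_coef !sigma_frac1 => H' H.
  rewrite W_comm.
  apply: (eq_of_linear_comb 5760 (-5760) _ _ _ _ _ _ _ H H') => //.
  by field.
Qed.
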